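(* Consider a Markov chain given by moves $(\Omega,G,c,m)$ as in the context and let $\theta:(0,\infty)^2\to[0,\infty)$ be a weight function that is not identically $0$, symmetric, differentiable and concave. For every $(\eta,\sigma)\in S$ let $c^{\mathrm{cpl}}(\eta,\sigma\eta,\cdot,\cdot)$ be coupling rates between $\eta$ and $\sigma\eta$. Then for all $\rho:\Omega\to(0,\infty)$ and $\psi:\Omega\to\mathbb{R}$, $$\mathscr{B}(\rho,\psi)\ \ge\ \frac14\sum_{(\eta,\sigma)\in S}\ \sum_{\gamma,\bar\gamma\in G^*}m(\eta)\,c(\eta,\sigma)\,c^{\mathrm{cpl}}(\eta,\sigma\eta,\gamma,\bar\gamma)\,J(\eta,\sigma,\gamma,\bar\gamma),$$ where $J:\Omega\times G^*\times G^*\times G^*\to\mathbb{R}$ is defined by $$J(\eta,\sigma,\gamma,\bar\gamma)=\big\{\theta(\rho(\gamma\eta),\rho(\bar\gamma\sigma\eta))+\theta(\rho(\eta),\rho(\sigma\eta))\big\}[\psi(\eta)-\psi(\sigma\eta)]^2-2\,\theta(\rho(\eta),\rho(\sigma\eta))(\psi(\eta)-\psi(\sigma\eta))(\psi(\gamma\eta)-\psi(\bar\gamma\sigma\eta)).$$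
   Context: **Setting.** $\Omega$ is an at most countable state space; $G$ is a finite set of moves (maps $\sigma:\Omega\to\Omega$, with $\sigma\eta:=\sigma(\eta)$) not containing the identity map $e$; $G^*=G\cup\{e\}$; $c:\Omega\times G\to[0,\infty)$ are transition rates; the chain is irreducible with invariant probability measure $m$, and $\sum_{\eta,\sigma}m(\eta)c(\eta,\sigma)<\infty$. Each $\sigma\in G$ has a unique inverse $\sigma^{-1}\in G$ with $\sigma^{-1}\sigma\eta=\eta$ whenever $m(\eta)c(\eta,\sigma)>0$, and reversibility holds: $\sum_{\eta,\sigma}m(\eta)c(\eta,\sigma)F(\eta,\sigma)=\sum_{\eta,\sigma}m(\eta)c(\eta,\sigma)F(\sigma\eta,\sigma^{-1})$ for all bounded $F:\Omega\times G\to\mathbb{R}$. Generator: $\mathcal{L}\psi(\eta)=\sum_{\sigma\in G}c(\eta,\sigma)(\psi(\sigma\eta)-\psi(\eta))$. $S=\{(\eta,\sigma)\in\Omega\times G:c(\eta,\sigma)>0\}$. **Coupling rates.** For states $\eta\neq\bar\eta$, coupling rates between them are a function $c^{\mathrm{cpl}}(\eta,\bar\eta,\cdot,\cdot):G^*\times G^*\to[0,\infty)$ with $$\sum_{\bar\gamma\in G^*}c^{\mathrm{cpl}}(\eta,\bar\eta,\gamma,\bar\gamma)=c(\eta,\gamma)\ \ \forall\gamma\in G,\qquad \sum_{\gamma\in G^*}c^{\mathrm{cpl}}(\eta,\bar\eta,\gamma,\bar\gamma)=c(\bar\eta,\bar\gamma)\ \ \forall\bar\gamma\in G.$$ (If $\sigma\eta=\eta$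 then $J(\eta,\sigma,\cdot,\cdot)=0$, so the value of $c^{\mathrm{cpl}}(\eta,\eta,\cdot,\cdot)$ is immaterial.) **Functionals.** $$\mathscr{C}(\rho,\psi)=\tfrac14\sum_{(\eta,\sigma)\in S}m(\eta)c(\eta,\sigma)\Big\{\partial_1\theta(\rho(\eta),\rho(\sigma\eta))\,\mathcal{L}\rho(\eta)+\partial_2\theta(\rho(\eta),\rho(\sigma\eta))\,\mathcal{L}\rho(\sigma\eta)\Big\}[\psi(\eta)-\psi(\sigma\eta)]^2,$$ $$\mathscr{D}(\rho,\psi)=\tfrac12\sum_{(\eta,\sigma)\in S}m(\eta)c(\eta,\sigma)\,\theta(\rho(\eta),\rho(\sigma\eta))(\psi(\eta)-\psi(\sigma\eta))(\mathcal{L}\psi(\eta)-\mathcal{L}\psi(\sigma\eta)),$$ and $\mathscr{B}(\rho,\psi)=\mathscr{C}(\rho,\psi)-\mathscr{D}(\rho,\psi)$. *)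

(* Defs.v *)
From mathcomp Require Export all_boot all_order all_algebra finmap.
From mathcomp Require Export all_classical all_reals all_analysis.

Set Implicit Arguments.
Unset Strict Implicit.
Unset Printing Implicit Defensive.

Import Order.TTheory GRing.Theory Num.Theory.
Import numFieldNormedType.Exports.

Local Open Scope classical_set_scope.
Local Open Scope ring_scope.

(** * Sums of signed families

   Unconditional summation: positive parts minus negative parts, as in the
   definition of the integral. [sum_defined D f] excludes [+oo - +oo] (which the
   library sets to [-oo]); it holds when [D] is finite and [f] real-valued. *)
Definition signed_sum (R : realType) (T : choiceType) (D : set T)
    (f : T -> \bar R) : \bar R :=
  (\esum_(x in D) f^\+ x - \esum_(x in D) f^\- x)%E.

Definition sum_defined (R : realType) (T : choiceType) (D : set T)
    (f : T -> \bar R) : bool :=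
  adde_def (\esum_(x in D) f^\+%E x) (- \esum_(x in D) f^\-%E x)%E.

(** * Markov chains given by moves

   [c] and the inverse [inv] are functions of arbitrary maps [Omega -> Omega],
   but only their values on [G] are used. *)
Section Moves.
Variables (R : realType) (Omega : countType) (G : {fset (Omega -> Omega)}).
Implicit Types (c : Omega -> (Omega -> Omega) -> R) (m : Omega -> R).

Definition Gstar : {fset (Omega -> Omega)} := ((id : Omega -> Omega) |` G)%fset.

Definition jump c : rel Omega :=
  fun eta xi => has (fun s => (0 < c eta s) && (s eta == xi)) G.

Definition irreducible_chain c : Prop :=
  forall eta xi : Omega, exists p, path (jump c) eta p /\ last eta p = xi.

Definition probability_mass m : Prop :=
  (forall eta, 0 <= m eta) /\ (\esum_(eta in setT) (m eta)%:E = 1)%E.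

(* Global balance: the flow of [m] into each state equals the flow out of it
   (moves fixing a state contribute equally to both sides). *)
Definition invariant_mass c m : Prop :=
  forall xi, (\esum_(p in [set p : Omega * (Omega -> Omega) |
                           (p.2 \in G) && (p.2 p.1 == xi)])
                (m p.1 * c p.1 p.2)%:E
              = (m xi * \sum_(s <- G) c xi s)%:E)%E.

(* Under [finite_flow] both sums in [reversible] converge absolutely. *)
Definition finite_flow c m : Prop :=
  (\esum_(eta in setT) (\sum_(s <- G) m eta * c eta s)%:E < +oo)%E.

Definition inverse_move c m (s t : Omega -> Omega) : Prop :=
  t \in G /\ forall eta, 0 < m eta * c eta s -> t (s eta) = eta.

Definition reversible c m (inv : (Omega -> Omega) -> (Omega -> Omega)) : Prop :=
  forall F : Omega -> (Omega -> Omega) -> R,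
    (exists M, forall eta s, s \in G -> `|F eta s| <= M) ->
    signed_sum setT (fun eta => (\sum_(s <- G) m eta * c eta s * F eta s)%:E)
    = signed_sum setT
        (fun eta => (\sum_(s <- G) m eta * c eta s * F (s eta) (inv s))%:E).

Record markov_moves c m : Prop := MarkovMoves {
  moves_neq_id : (id : Omega -> Omega) \notin G ;
  rates_ge0 : forall eta s, s \in G -> 0 <= c eta s ;
  moves_irreducible : irreducible_chain c ;
  moves_probability : probability_mass m ;
  moves_invariant : invariant_mass c m ;
  moves_finite_flow : finite_flow c m ;
  moves_reversible : exists inv : (Omega -> Omega) -> (Omega -> Omega),
    (forall s, s \in G -> unique (inverse_move c m s) (inv s)) /\
    reversible c m inv
}.

Definition supp_moves c : set (Omega * (Omega -> Omega)) :=
  [set p | p.2 \in G /\ 0 < c p.1 p.2].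

Definition generator c (psi : Omega -> R) (eta : Omega) : R :=
  \sum_(s <- G) c eta s * (psi (s eta) - psi eta).

Record coupling_rates c (eta xi : Omega)
    (k : (Omega -> Omega) -> (Omega -> Omega) -> R) : Prop := CouplingRates {
  coupling_ge0 : forall g h, g \in Gstar -> h \in Gstar -> 0 <= k g h ;
  coupling_left : forall g, g \in G -> \sum_(h <- Gstar) k g h = c eta g ;
  coupling_right : forall h, h \in G -> \sum_(g <- Gstar) k g h = c xi h
}.

End Moves.

(** * Weight functions on the open quadrant *)

Definition pos_quadrant (R : realType) : set (R * R) :=
  [set x | 0 < x.1 /\ 0 < x.2].

(* Only the values of [theta] on [pos_quadrant R] matter. *)
Record weight_function (R : realType) (theta : R * R -> R) : Prop :=
  WeightFunction {
  weight_ge0 : forall x, pos_quadrant x -> 0 <= theta x ;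
  weight_neq0 : exists2 x, pos_quadrant x & theta x != 0 ;
  weight_sym : forall s t, 0 < s -> 0 < t -> theta (s, t) = theta (t, s) ;
  weight_diff : forall x, pos_quadrant x -> differentiable theta x ;
  weight_concave : convex_function (E := (R^o * R^o)%type) (@pos_quadrant R)
                     (fun x => - theta x)
}.

Definition partial1 (R : realType) (theta : R * R -> R) (s t : R) : R :=
  derive1 (fun x => theta (x, t)) s.

Definition partial2 (R : realType) (theta : R * R -> R) (s t : R) : R :=
  derive1 (fun y => theta (s, y)) t.

(** * The functionals *)

Section Functionals.
Variables (R : realType) (Omega : countType) (G : {fset (Omega -> Omega)}).
Variables (c : Omega -> (Omega -> Omega) -> R) (m : Omega -> R).
Variables (theta : R * R -> R) (rho psi : Omega -> R).

Local Notation L := (generator G c).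
Local Notation S := (supp_moves G c).

Definition C_term (p : Omega * (Omega -> Omega)) : \bar R :=
  let eta := p.1 in let s := p.2 in
  (m eta * c eta s
   * (partial1 theta (rho eta) (rho (s eta)) * L rho eta
      + partial2 theta (rho eta) (rho (s eta)) * L rho (s eta))
   * (psi eta - psi (s eta)) ^+ 2)%:E.

Definition D_term (p : Omega * (Omega -> Omega)) : \bar R :=
  let eta := p.1 in let s := p.2 in
  (m eta * c eta s * theta (rho eta, rho (s eta))
   * (psi eta - psi (s eta)) * (L psi eta - L psi (s eta)))%:E.

Definition C_fun : \bar R := ((4^-1)%:E * signed_sum S C_term)%E.

Definition D_fun : \bar R := ((2^-1)%:E * signed_sum S D_term)%E.

Definition B_fun : \bar R := (C_fun - D_fun)%E.

(* The three differences entering [B_fun] are not of the form [oo - oo]; this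
   always holds when [Omega] is finite. *)
Definition B_defined : bool :=
  [&& sum_defined S C_term, sum_defined S D_term & adde_def C_fun (- D_fun)%E].

Definition J (eta : Omega) (s g h : Omega -> Omega) : R :=
  (theta (rho (g eta), rho (h (s eta))) + theta (rho eta, rho (s eta)))
    * (psi eta - psi (s eta)) ^+ 2
  - 2 * theta (rho eta, rho (s eta)) * (psi eta - psi (s eta))
      * (psi (g eta) - psi (h (s eta))).

End Functionals.

(* Main.v *)
Require Import Defs.
From mathcomp Require Import lra ring.

(** The inequality holds term by term. Let d = psi eta - psi (sigma eta) and
   w = theta (rho eta, rho (sigma eta)). Since
   psi (g eta) - psi (h (sigma eta))
     = d + (psi (g eta) - psi eta) - (psi (h (sigma eta)) - psi (sigma eta)),
   J equals (theta (rho (g eta), rho (h (sigma eta))) - w) d^2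
     - 2 w d ((psi (g eta) - psi eta) - (psi (h (sigma eta)) - psi (sigma eta))).
   By concavity the first summand is at most the differential of theta at
   (rho eta, rho (sigma eta)) applied to the increments of rho, times d^2.
   Every term is then linear in increments along g or along h, so averaging
   against the coupling rates turns increments into generators. *)

Set Implicit Arguments.
Unset Strict Implicit.

Import Order.TTheory GRing.Theory Num.Theory.
Import numFieldNormedType.Exports.

Local Open Scope classical_set_scope.
Local Open Scope ring_scope.

(** Both derivatives are limits of the same difference quotient. In directional form they combine by
    linearity of the differential. *)
Lemma partial1E (R : realType) (theta : R * R -> R) (s t : R) :
  partial1 theta s t = 'D_(1, 0) theta (s, t).
Proof.
rewrite /partial1 /derive1 /derive.
set d := (fun _ : R => _); set d' := (fun _ : R => _).
suff -> : d = d' by [].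
apply/funext => h; rewrite /d /d' /= /shift.
suff -> : h *: ((1, 0) : R * R) + (s, t) = (h + s, t) by [].
by congr (_, _); rewrite /= /GRing.scale /= ?mulr1 // mulr0 add0r.
Qed.

Lemma partial2E (R : realType) (theta : R * R -> R) (s t : R) :
  partial2 theta s t = 'D_(0, 1) theta (s, t).
Proof.
rewrite /partial2 /derive1 /derive.
set d := (fun _ : R => _); set d' := (fun _ : R => _).
suff -> : d = d' by [].
apply/funext => h; rewrite /d /d' /= /shift.
suff -> : h *: ((0, 1) : R * R) + (s, t) = (s, h + t) by [].
by congr (_, _); rewrite /= /GRing.scale /= ?mulr1 // mulr0 add0r.
Qed.

Lemma concave_chord (R : realType) (theta : R * R -> R) (x y : R * R) (h : R) :
  convex_function (E := (R^o * R^o)%type) (@pos_quadrant R)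
    (fun x => - theta x) ->
  pos_quadrant x -> pos_quadrant y ->
  0 <= h -> h <= 1 ->
  h * (theta y - theta x) <= theta (h *: (y - x) + x) - theta x.
Proof.
move=> cvx px py h0 h1.
have := cvx (Itv01 h0 h1) y x.
rewrite !inE => /(_ py px).
rewrite convRE /= /unstable.onem.
set z := (X in - theta X <= _).
have -> : z = h *: (y - x) + x :> R * R.
  rewrite /z /conv /= /unstable.onem.
  by rewrite scalerBl scalerBr scale1r addrCA addrC.
lra.
Qed.

(** The right-hand side is the derivative of [theta] at [(s, t)] towards [(s', t')]; [concave_chord]
    bounds its difference quotients from below. *)
Lemma concave_le_tangent (R : realType) (theta : R * R -> R) (s t s' t' : R) :
  convex_function (E := (R^o * R^o)%type) (@pos_quadrant R)
    (fun x => - theta x) ->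
  differentiable theta (s, t) -> 0 < s -> 0 < t -> 0 < s' -> 0 < t' ->
  theta (s', t') - theta (s, t)
  <= partial1 theta s t * (s' - s) + partial2 theta s t * (t' - t).
Proof.
move=> cvx dth s0 t0 s'0 t'0.
have -> : partial1 theta s t * (s' - s) + partial2 theta s t * (t' - t)
   = 'D_((s', t') - (s, t)) theta (s, t).
  rewrite partial1E partial2E !deriveE //.
  rewrite mulrC [X in _ + X]mulrC -!linearZ -linearD; congr ('d theta _ _).
  by congr (_, _); rewrite /= /GRing.scale /= ?mulr1 ?mulr0 ?addr0 ?add0r.
have drv := @diff_derivable _ _ _ _ _ ((s', t') - (s, t)) dth.
(* A one-sided limit suffices, and the chord bound is available only for steps [h] in (0, 1]. *)
apply: (cvgr_to_ge (cvg_dnbhs_at_right drv)).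
near=> h.
have h0 : 0 < h by near: h; exact: nbhs_right_gt.
have h1 : h <= 1 by near: h; exact: nbhs_right_le.
rewrite /= [leRHS]mulrC ler_pdivlMr // mulrC.
exact: concave_chord.
Unshelve. all: end_near.
Qed.

(* [fp - fn] may be [oo - oo]; its value [-oo] makes the conclusion trivial. *)
Lemma ereal_quarter_le_sub_half (R : realType) (fp fn ap an bp bn : \bar R) :
  (0 <= fp -> 0 <= fn -> 0 <= ap -> 0 <= an -> 0 <= bp -> 0 <= bn ->
   fp + an + (bp + bp) <= ap + (bn + bn) + fn ->
   ap +? - an -> bp +? - bn ->
   (4^-1)%:E * (ap - an) +? - ((2^-1)%:E * (bp - bn)) ->
   (4^-1)%:E * (fp - fn) <= (4^-1)%:E * (ap - an) - (2^-1)%:E * (bp - bn))%E.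
Proof.
have h4 : (0 < (4^-1)%:E :> \bar R)%E by rewrite lte_fin.
have h2 : (0 < (2^-1)%:E :> \bar R)%E by rewrite lte_fin.
have lim0 : (0 <= -oo :> \bar R)%E = false by [].
(* Nonnegativity discards [-oo]. The cases with an infinite value close by computation, so only six
   reals reach the final [lra]. *)
case: fp => [fp| |]; rewrite ?lim0 // => _.
all: case: fn => [fn| |]; rewrite ?lim0 // => _.
all: case: ap => [ap| |]; rewrite ?lim0 // => _.
all: case: an => [an| |]; rewrite ?lim0 // => _.
all: case: bp => [bp| |]; rewrite ?lim0 // => _.
all: case: bn => [bn| |]; rewrite ?lim0 // => _.
all: rewrite /= ?(gt0_muley h4) ?(gt0_muley h2).
all: rewrite ?(gt0_muleNy h4) ?(gt0_muleNy h2) ?leey ?leNye //=.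
all: rewrite ?leey ?leNye //.
move=> + _ _ _; rewrite -?EFinD -?EFinM -?EFinD !lee_fin.
lra.
Qed.

(** Positive and negative parts are moved to the side where they carry a plus sign. The pointwise
    bound then sums in [0, +oo], with no convergence of the sum of [f] assumed. The factor 2 is the
    ratio of 1/2 to 1/4. *)
Lemma signed_sum_le_sub (R : realType) (T : choiceType) (D : set T)
    (f a b : T -> R) :
  (forall x, D x -> f x + 2 * b x <= a x) ->
  sum_defined D (EFin \o a) -> sum_defined D (EFin \o b) ->
  ((4^-1)%:E * signed_sum D (EFin \o a)
     +? - ((2^-1)%:E * signed_sum D (EFin \o b)))%E ->
  ((4^-1)%:E * signed_sum D (EFin \o f)
   <= (4^-1)%:E * signed_sum D (EFin \o a)
      - (2^-1)%:E * signed_sum D (EFin \o b))%E.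
Proof.
rewrite /signed_sum /sum_defined => fba.
set fp := \esum_(x in D) (EFin \o f)^\+%E x.
set fn := \esum_(x in D) (EFin \o f)^\-%E x.
set ap := \esum_(x in D) (EFin \o a)^\+%E x.
set an := \esum_(x in D) (EFin \o a)^\-%E x.
set bp := \esum_(x in D) (EFin \o b)^\+%E x.
set bn := \esum_(x in D) (EFin \o b)^\-%E x.
have main : (fp + an + (bp + bp) <= ap + (bn + bn) + fn)%E.
  rewrite /fp /an /bp /ap /bn /fn -!esumD //;
    try by move=> x _; rewrite ?adde_ge0.
  apply: le_esum => x Dx; have := fba x Dx.
  rewrite !funeposE !funenegE /= -!EFin_max -!EFinD lee_fin.
  by rewrite /Num.max; do 6 (case: ltP => ?); lra.
apply: ereal_quarter_le_sub_half main; exact: esum_ge0.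
Qed.

(** An increment along [g] does not depend on [h], so summing [k] over [h] leaves the marginal rate
    [c eta g]; likewise with the roles exchanged. The marginals at [id] are unconstrained, but the
    increment along [id] is zero. *)
Lemma sum_coupling (R : realType) (Omega : countType)
    (G : {fset (Omega -> Omega)}) (c : Omega -> (Omega -> Omega) -> R)
    (eta xi : Omega) (k : (Omega -> Omega) -> (Omega -> Omega) -> R)
    (a b : R) (u : Omega -> R) :
  (id : Omega -> Omega) \notin G -> coupling_rates G c eta xi k ->
  \sum_(g <- Gstar G) \sum_(h <- Gstar G)
     k g h * (a * (u (g eta) - u eta) + b * (u (h xi) - u xi))
  = a * generator G c u eta + b * generator G c u xi.
Proof.
move=> idG ck.
under eq_bigr do under eq_bigr do rewrite mulrDr !mulrA.
under eq_bigr do rewrite big_split /=.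
rewrite big_split /=; congr (_ + _).
- rewrite /Gstar big_fsetU1 //= subrr big1 ?add0r => [|? _]; last exact: mulr0.
  rewrite /generator mulr_sumr; apply: eq_big_seq => g gG.
  by rewrite -(coupling_left ck gG) -!mulr_suml mulrCA mulrA.
- rewrite exchange_big /= /Gstar big_fsetU1 //= subrr big1 ?add0r => [|? _];
    last exact: mulr0.
  rewrite /generator mulr_sumr; apply: eq_big_seq => g gG.
  by rewrite -(coupling_right ck gG) -!mulr_suml mulrCA mulrA.
Qed.

Lemma sum_coupling_J_le (R : realType) (Omega : countType)
    (G : {fset (Omega -> Omega)}) (c : Omega -> (Omega -> Omega) -> R)
    (theta : R * R -> R) (rho psi : Omega -> R)
    (k : (Omega -> Omega) -> (Omega -> Omega) -> R)
    (eta : Omega) (s : Omega -> Omega) :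
  (id : Omega -> Omega) \notin G ->
  weight_function theta -> (forall eta, 0 < rho eta) ->
  coupling_rates G c eta (s eta) k ->
  \sum_(g <- Gstar G) \sum_(h <- Gstar G) k g h * J theta rho psi eta s g h
  + 2 * (theta (rho eta, rho (s eta)) * (psi eta - psi (s eta))
         * (generator G c psi eta - generator G c psi (s eta)))
  <= (partial1 theta (rho eta) (rho (s eta)) * generator G c rho eta
      + partial2 theta (rho eta) (rho (s eta)) * generator G c rho (s eta))
     * (psi eta - psi (s eta)) ^+ 2.
Proof.
move=> idG wt rho0 ck.
(* The generators are expanded back into sums against [k], which reduces the claim to one inequality
   for each pair [(g, h)]. *)
rewrite -(sum_coupling _ _ rho idG ck).
set w := theta _; set d := psi eta - psi (s eta).
have -> : generator G c psi eta - generator G c psi (s eta)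
   = 1 * generator G c psi eta + (-1) * generator G c psi (s eta) by ring.
rewrite -(sum_coupling _ _ psi idG ck) !mulr_sumr mulr_suml -big_split /=.
rewrite big_seq [leRHS]big_seq; apply: ler_sum => g gG.
rewrite !mulr_sumr mulr_suml -big_split /=.
rewrite big_seq [leRHS]big_seq; apply: ler_sum => h hG.
have dth : differentiable theta (rho eta, rho (s eta)).
  by apply: (weight_diff wt); split; apply: rho0.
have tan := concave_le_tangent (weight_concave wt) dth (rho0 eta)
  (rho0 (s eta)) (rho0 (g eta)) (rho0 (h (s eta))).
rewrite /J -/w -/d.
(* The tangent bound is scaled by [k g h * d ^+ 2]; the increments of [psi] on the two sides then
   cancel exactly. *)
have := ler_wpM2l (mulr_ge0 (coupling_ge0 ck gG hG) (sqr_ge0 d)) tan.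
rewrite -/w /d; lra.
Qed.

Theorem lemma3p1 (R : realType) (Omega : countType)
    (G : {fset (Omega -> Omega)})
    (c : Omega -> (Omega -> Omega) -> R) (m : Omega -> R)
    (chain : markov_moves G c m)
    (theta : R * R -> R) (theta_weight : weight_function theta)
    (ccpl : Omega -> Omega -> (Omega -> Omega) -> (Omega -> Omega) -> R)
    (cpl : forall (eta : Omega) (s : Omega -> Omega),
       supp_moves G c (eta, s) -> s eta != eta ->
       coupling_rates G c eta (s eta) (ccpl eta (s eta)))
    (rho psi : Omega -> R) (rho_gt0 : forall eta, 0 < rho eta)
    (B_def : B_defined G c m theta rho psi) :
  ((4^-1)%:E *
   signed_sum (supp_moves G c)
     (fun p : Omega * (Omega -> Omega) =>
        (\sum_(g <- Gstar G) \sum_(h <- Gstar G)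
           m p.1 * c p.1 p.2 * ccpl p.1 (p.2 p.1) g h
           * J theta rho psi p.1 p.2 g h)%:E)
   <= B_fun G c m theta rho psi)%E.
Proof.
case/and3P: B_def => Cdef Ddef CDdef.
(* Here [a] and [b] are the summands of [C_fun] and [D_fun], and [f] is the coupling sum. *)
apply: signed_sum_le_sub Cdef Ddef CDdef => -[eta s] Ss /=.
(* [ccpl eta eta] is unconstrained, but [J] vanishes there. *)
have [sE|sN] := eqVneq (s eta) eta.
  rewrite sE subrr expr0n /= !(mulr0, mul0r) addr0 big1 // => g _.
  rewrite big1 // => h _.
  by rewrite /J sE subrr expr0n /= !(mulr0, mul0r) subrr mulr0.
have w0 : 0 <= m eta * c eta s.
  by rewrite mulr_ge0 ?(ltW Ss.2) //; exact: (moves_probability chain).1.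
have := ler_wpM2l w0 (sum_coupling_J_le psi (moves_neq_id chain) theta_weight
  rho_gt0 (cpl _ _ Ss sN)).
set x := (X in X <= _ -> _); set y := (X in _ <= X -> _) => xy.
set z := (X in X <= _); set t := (X in _ <= X).
suff [-> ->] : z = x /\ t = y by [].
rewrite /x /y /z /t; split; last by rewrite !mulrA.
rewrite [RHS]mulrDr mulr_sumr; congr (_ + _); last by ring.
apply: eq_bigr => g _; rewrite mulr_sumr.
by apply: eq_bigr => h _; rewrite !mulrA.
Qed.
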